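(* Let $\{f_1,\ldots,f_q\}$ be an iterated function system consisting of injective contractions of a complete metric space, and let $T$ be its attractor. Suppose that $T$ is connected, and let $$E:=\bigcup_{\substack{\alpha,\beta\in\{1,\ldots,q\}^*\\ \#(f_\alpha(T)\cap f_\beta(T))=1}} \bigl(f_\alpha(T)\cap f_\beta(T)\bigr).$$ Then either $T$ has a cut point, or each irreducible cut set $X$ of $T$ admits a partition $X=X'\cup X_0$ with $X_0\subset E$.
   Context: The attractor of an iterated function system (IFS) $\{f_1,\ldots,f_q\}$ of injective contractions on a complete metric space is the unique nonempty compact set $T$ with $T=\bigcup_{i=1}^q f_i(T)$. $\{1,\ldots,q\}^*$ denotes the set of all nonempty finite words over $\{1,\ldots,q\}$; for a word $\alpha=i_1i_2\cdots i_n$ put $f_\alpha:=f_{i_1}\circ f_{i_2}\circ\cdots\circ f_{i_n}$. A cut set of a connected set $Y$ is a subset $X\subset Y$ such that $Y\setminus X$ is disconnected; a cut point of $Y$ is a point $x\in Y$ such that $\{x\}$ is a cut set of $Y$. A cut set $X$ of a connected set $Y$ is irreducible if $Y\setminus X_0$ is connected for every proper subset $X_0$ of $X$ which is closed in $Y$. For $X\subset Y$, the derived set $X'$ is the set of limit points of $X$. A partition is a decomposition into disjoint (possibly empty) sets. ''Either ... or'' is understood inclusively (at least one alternative holds). *)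

(* Defs.v *)
From HB Require Import structures.
From mathcomp Require Import all_boot all_order all_algebra.
From mathcomp Require Import all_classical all_reals all_analysis.

Set Implicit Arguments.
Unset Strict Implicit.
Unset Printing Implicit Defensive.

Import Order.TTheory GRing.Theory Num.Theory.

Local Open Scope classical_set_scope.
Local Open Scope ring_scope.

(* The library's completeType is pointed, hence nonempty; this is harmless for
   a space that contains an attractor. *)
#[short(type="completeMetricType")]
HB.structure Definition CompleteMetric (K : numDomainType) :=
  {M of Complete M & Metric K M}.

(* The library's [contraction] is only stated for normed modules. *)
Definition metric_contraction (R : realType) (M : metricType R) (g : M -> M) :=
  exists c : R, 0 <= c < 1 /\ forall x y, mdist (g x) (g y) <= c * mdist x y.

(* For contractions of a complete metric space, such a T exists and is unique
   as soon as 0 < q; the nonemptiness of T forces 0 < q. *)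
Definition attractor (M : topologicalType) (q : nat) (f : 'I_q -> M -> M)
    (T : set M) :=
  [/\ T !=set0, compact T & T = \bigcup_i (f i @` T)].

Definition word_map (M : Type) (q : nat) (f : 'I_q -> M -> M)
    (alpha : seq 'I_q) : M -> M :=
  foldr (fun i g => f i \o g) id alpha.

Definition single_overlaps (M : Type) (q : nat) (f : 'I_q -> M -> M)
    (T : set M) : set M :=
  \bigcup_(ab in [set ab : seq 'I_q * seq 'I_q |
      [/\ ab.1 != [::], ab.2 != [::] &
          ((word_map f ab.1 @` T) `&` (word_map f ab.2 @` T) #= `I_1)%card]])
    ((word_map f ab.1 @` T) `&` (word_map f ab.2 @` T)).

Definition cut_set (M : topologicalType) (Y X : set M) :=
  X `<=` Y /\ ~ connected (Y `\` X).

Definition cut_point (M : topologicalType) (Y : set M) (x : M) :=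
  Y x /\ cut_set Y [set x].

(* [subspace Y] is M with the topology making Y clopen and the points outside Y
   isolated, so for X0 `<=` Y closedness there is relative closedness in Y. *)
Definition irreducible_cut_set (M : topologicalType) (Y X : set M) :=
  cut_set Y X /\
  forall X0 : set M, X0 `<` X -> closed (X0 : set (subspace Y)) ->
    connected (Y `\` X0).

(* Main.v *)
(* Separated sets of a metric space lie in disjoint open sets U and V, so
   irreducibility forces X = T \ (U u V); hence X is closed and X0 is the set of
   its isolated points.  If x is isolated in X, then T \ (X \ {x}) is connected,
   so x lies in the closure of both T n U and T n V.  Take n such that the
   finitely many pieces f_a(T), |a| = n, that contain x meet X only in x.  These
   pieces cover T near x, and each of them is still connected without x since T
   has no cut point, so each of them minus x lies in U or in V.  Both cases
   occur, and a piece of one kind meets a piece of the other kind only in x. *)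

Require Import Defs.
From HB Require Import structures.
From mathcomp Require Import all_boot all_order all_algebra.
From mathcomp Require Import all_classical all_reals all_analysis.
From mathcomp Require Import lra.

Set Implicit Arguments.
Unset Strict Implicit.
Unset Printing Implicit Defensive.

Import Order.TTheory GRing.Theory Num.Theory.

Local Open Scope classical_set_scope.
Local Open Scope ring_scope.

Lemma open_separated (M : topologicalType) (U V : set M) :
  open U -> open V -> U `&` V = set0 -> separated U V.
Proof.
have disj (A B : set M) : open B -> A `&` B = set0 -> closure A `&` B = set0.
  move=> oB AB0; rewrite -subset0 => x [clAx Bx].
  have [y [Ay By]] := clAx B (open_nbhs_nbhs (conj oB Bx)).
  exact: (disjoints_subset _ _).1 AB0 _ Ay By.
by move=> oU oV UV0; split; [|rewrite setIC]; apply: disj; rewrite // setIC.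
Qed.

(* [N A B] is a union of balls centred in A whose radii are at most half the
   distance from their centre to B. *)
Lemma separated_open_nbhs (R : realType) (M : metricType R) (A B : set M) :
  separated A B ->
  exists U V : set M,
    [/\ open U, open V, A `<=` U, B `<=` V & U `&` V = set0].
Proof.
pose N (A B : set M) := [set y | exists a e, [/\ A a, 0 < e,
  forall b, B b -> e * 2 <= mdist a b & mdist a y < e]].
have oN A' B' : open (N A' B').
  rewrite openE => y [a [e [Aa e0 Be aye]]].
  rewrite /interior -nbhs_ballE; exists (e - mdist a y) => /=.
    by rewrite subr_gt0.
  move=> z; rewrite ballEmdist/= => yz; exists a, e; split=> //.
  by have := metric_triangle a y z; lra.
have subN A' B' : A' `&` closure B' = set0 -> A' `<=` N A' B'.
  move=> AB0 a Aa.
  have /existsNP[W /not_implyP[]] := (disjoints_subset _ _).1 AB0 _ Aa.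
  rewrite -nbhs_ballE => -[e /= e0 eW] BW0.
  exists a, (e / 2); rewrite mdistxx divr_gt0//; split=> // b Bb.
  rewrite divfK ?gt_eqF// leNgt; apply/negP => abe; apply: BW0.
  by exists b; split=> //; apply: eW; rewrite ballEmdist.
move=> [AB BA]; exists (N A B), (N B A); split=> //.
- exact: subN.
- by apply: subN; rewrite setIC.
rewrite -subset0 => y [[a [e [Aa e0 Be aye]]] [b [e' [Bb e'0 Ae bye]]]].
have := Be _ Bb; have := Ae _ Aa; have := metric_triangle a y b.
by rewrite (metric_sym y b) (metric_sym b a); lra.
Qed.

Lemma irreducible_cut_set_open (R : realType) (M : metricType R) (T X : set M) :
  closed T -> irreducible_cut_set T X ->
  exists U V : set M, [/\ [/\ open U, open V & U `&` V = set0],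
    T `&` U !=set0, T `&` V !=set0 & X = T `\` (U `|` V)].
Proof.
move=> clT [[XT /connectedPn[E [E0 TXE sE]]] irrX].
have [U [V [oU oV EU EV UV0]]] := separated_open_nbhs sE.
have subT b : E b `<=` T.
  move=> x Ex; suff [] : (T `\` X) x by [].
  by rewrite TXE; case: b Ex => ?; [right|left].
have TU0 : T `&` U !=set0.
  by have [x Ex] := E0 false; exists x; split; [exact: subT Ex|exact: EU].
have TV0 : T `&` V !=set0.
  by have [x Ex] := E0 true; exists x; split; [exact: subT Ex|exact: EV].
exists U, V; split=> //.
have YX : T `\` (U `|` V) `<=` X.
  move=> x [Tx nUVx]; apply: contrapT => nXx; apply: nUVx.
  have : (T `\` X) x by [].
  by rewrite TXE => -[/EU|/EV]; [left|right].
have TY : T `\` (T `\` (U `|` V)) = T `&` (U `|` V).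
  by rewrite setDD.
apply: contrapT => XY; suff : connected (T `&` (U `|` V)).
  move/(connected_subset (open_separated oU oV UV0) (@subIsetr _ _ _)).
  have no := (disjoints_subset _ _).1 UV0.
  move=> [] TUV.
  - have [x [Tx Vx]] := TV0.
    by apply: (no x) => //; apply: TUV; split=> //; right.
  - have [x [Tx Ux]] := TU0.
    by apply: (no x) => //; apply: TUV; split=> //; left.
rewrite -TY; apply: irrX.
  by rewrite properEneq; split=> //; apply/eqP => YX'; apply: XY.
apply: closed_subspaceW; apply: closedI => //.
by apply: open_closedC; exact: openU.
Qed.

Lemma irreducible_cut_set_isolated_closure (R : realType) (M : metricType R)
    (T X U V : set M) (x : M) :
  closed T -> irreducible_cut_set T X ->
  open U -> open V -> U `&` V = set0 -> T `&` U !=set0 -> T `&` V !=set0 ->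
  X = T `\` (U `|` V) -> isolated X x -> closure (T `&` U) x.
Proof.
move=> clT [[XT _] irrX] oU oV UV0 TU0 [v [Tv Vv]] XE [/set_mem Xx [W xW WX]].
have clX : closed X.
  by rewrite XE; apply: closedI => //; apply: open_closedC; exact: openU.
have no := (disjoints_subset _ _).1 UV0.
have XxE : X `\ x = X `\` W°.
  apply/seteqP; split=> y [Xy].
    move=> yx; split=> // /interior_subset Wy; apply: yx.
    have : (W `&` X) y by [].
    by rewrite WX.
  by move=> nWy; split=> // yx; apply: nWy; rewrite yx.
have : connected (T `\` (X `\ x)).
  apply: irrX.
    by split=> [y []//|/(_ x Xx)[_]]; exact.
  apply: closed_subspaceW; rewrite XxE; apply: closedI => //.
  by apply: open_closedC; exact: open_interior.
have nUx : ~ U x by move: Xx; rewrite XE => -[_ nUV] Ux; apply: nUV; left.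
move=> /connectedP cXx; apply: contrapT => nclx.
apply: (cXx (fun b => if b then T `&` U else x |` (T `&` V))); split.
- by case=> //; exists v; right.
- apply/seteqP; split=> y.
    move=> [Ty nXy]; have [->|yx] := eqVneq y x; first by left; left.
    have : ~ X y by move=> Xy; apply: nXy; split=> //; apply/eqP.
    rewrite XE => nX; have : (U `|` V) y.
      by apply: contrapT => nUV; apply: nX; split.
    by case; [right|left; right].
  move=> [[->|[Ty Vy]]|[Ty Uy]].
  + by split; [exact: XT|move=> [_]; exact].
  + by split=> // -[]; rewrite XE => -[_ nUV] _; apply: nUV; right.
  + by split=> // -[]; rewrite XE => -[_ nUV] _; apply: nUV; left.
- have [sUV sVU] := open_separated oU oV UV0.
  have clx : closed [set x] by exact/accessible_closed_set1/hausdorff_accessible/metric_hausdorff.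
  split; rewrite -subset0 => y.
    rewrite closureU -(closure_id _).1// => -[[->|clVy] [Ty Uy]] //.
    by rewrite -sVU; split=> //; apply: closureS clVy => z [].
  move=> [[->//|[Ty Vy]]] clUy.
  by rewrite -sUV; split=> //; apply: closureS clUy => z [].
Qed.

Lemma compact_mdist_bounded (R : realType) (M : metricType R) (K : set M) :
  compact K -> exists D : R, forall x y, K x -> K y -> mdist x y < D.
Proof.
move=> /compact_near_coveringP cK; have [->|/set0P[p Kp]] := eqVneq K set0.
  by exists 0.
have : \forall r \near +oo%R, K `<=` [set y | mdist p y < r].
  apply: (cK R (+oo%R : set_system R) (fun r y => mdist p y < r)) => x Kx.
  exists (ball x 1, [set r | mdist p x + 1 < r]) => /=.
    by split; [exact: nbhsx_ballx|exact: nbhs_pinfty_gt (num_real _)].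
  move=> [y r] /= [+ pxr]; rewrite ballEmdist/= => xy1.
  by have := metric_triangle p x y; lra.
move=> /filter_ex[r Kr]; exists (r + r) => x y Kx Ky.
have := metric_triangle x p y; rewrite (metric_sym x p).
by have := Kr _ Kx; have := Kr _ Ky => /=; lra.
Qed.

Lemma common_contraction_ratio (R : realType) (M : metricType R) (q : nat)
    (f : 'I_q -> M -> M) :
  (forall i, metric_contraction (f i)) ->
  exists c : R, 0 <= c < 1 /\
    forall i x y, mdist (f i x) (f i y) <= c * mdist x y.
Proof.
move=> /choice[c fc]; exists (\big[Num.max/0]_i c i); split.
  by rewrite bigmax_ge_id bigmax_lt// => i _; have [/andP[]] := fc i.
move=> i x y; have [_ /(_ x y) fxy] := fc i; apply: le_trans fxy _.
by rewrite ler_wpM2r// ?mdist_ge0 ?le_bigmax.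
Qed.

Section word_map.
Context (R : realType) (M : metricType R) (q : nat) (f : 'I_q -> M -> M).

Lemma word_map_inj (a : seq 'I_q) :
  (forall i, injective (f i)) -> injective (word_map f a).
Proof.
by move=> f_inj; elim: a => [//|i a IH] x y /= /f_inj/IH.
Qed.

Lemma mdist_word_map (c : R) (a : seq 'I_q) (x y : M) : 0 <= c ->
  (forall i x y, mdist (f i x) (f i y) <= c * mdist x y) ->
  mdist (word_map f a x) (word_map f a y) <= c ^+ size a * mdist x y.
Proof.
move=> c0 fc; elim: a => [|i a IH] /=; first by rewrite expr0 mul1r.
by rewrite exprS -mulrA (le_trans (fc _ _ _))// ler_wpM2l.
Qed.

Lemma continuous_word_map (a : seq 'I_q) :
  (forall i, metric_contraction (f i)) -> continuous (word_map f a).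
Proof.
move=> /common_contraction_ratio[c [/andP[c0 c1] fc]] x.
apply/metricType_numDomainType.cvgrPdist_lt => e e0; near=> y.
apply: le_lt_trans (mdist_word_map _ _ _ c0 fc) _.
rewrite (@le_lt_trans _ _ (mdist x y))//.
  by rewrite ler_piMl ?mdist_ge0// exprn_ile1// ltW.
by near: y; exact: metricType_numDomainType.cvgr_dist_lt.
Unshelve. all: by end_near. Qed.

Variable T : set M.
Hypothesis T_attr : attractor f T.

Lemma word_map_attractor (a : seq 'I_q) : word_map f a @` T `<=` T.
Proof.
have [_ _ TE] := T_attr.
elim: a => [|i a IH] _ [x Tx <-] //=.
by rewrite TE; exists i => //; exists (word_map f a x) => //; apply: IH; exists x.
Qed.

Lemma attractor_words (n : nat) :
  T `<=` \bigcup_(a : n.-tuple 'I_q) (word_map f a @` T).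
Proof.
have [_ _ TE] := T_attr.
elim: n => [|n IH] x Tx; first by exists [tuple] => //; exists x.
move: Tx; rewrite {1}TE => -[i _ [y /IH[a _ [z Tz <-]] <-]].
by exists [tuple of i :: a] => //; exists z.
Qed.

Lemma attractor_small_pieces (e : R) :
  (forall i, metric_contraction (f i)) -> 0 < e ->
  exists2 n, (0 < n)%N & forall (a : n.-tuple 'I_q) x y, T x -> T y ->
    mdist (word_map f a x) (word_map f a y) < e.
Proof.
move=> /common_contraction_ratio[c [/andP[c0 c1] fc]] e0.
have [[p Tp] cT _] := T_attr.
have [D TD] := compact_mdist_bounded cT.
have D0 : 0 < D by apply: le_lt_trans (TD p p Tp Tp); rewrite mdist_ge0.
have cn : c ^+ n @[n --> \oo] --> 0 by apply: cvg_expr; rewrite ger0_norm.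
have : \forall n \near \oo, (0 < n)%N /\ `|c ^+ n| < e / D.
  near=> n; split; first by near: n; exact: nbhs_infty_gt.
  by near: n; apply: cvgr0_norm_lt; rewrite ? divr_gt0.
move=> /filter_ex[n [n0]]; rewrite ger0_norm ?exprn_ge0// ltr_pdivlMr// => ne.
exists n => // a x y Tx Ty.
apply: le_lt_trans (mdist_word_map _ _ _ c0 fc) _.
rewrite size_tuple; apply: le_lt_trans ne.
by rewrite ler_wpM2l ?exprn_ge0// ltW// TD.
Unshelve. all: by end_near. Qed.

Hypothesis f_inj : forall i, injective (f i).
Hypothesis f_contr : forall i, metric_contraction (f i).

Lemma connected_punctured_piece (a : seq 'I_q) (x : M) :
  ~ (exists x, cut_point T x) -> (word_map f a @` T) x ->
  connected ((word_map f a @` T) `\ x).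
Proof.
move=> ncut [y Ty <-].
have -> : (word_map f a @` T) `\ word_map f a y = word_map f a @` (T `\ y).
  apply/seteqP; split=> u.
    by move=> [[z Tz <-] zy]; exists z => //; split=> // zy'; apply: zy; rewrite zy'.
  move=> [z [Tz zy] <-]; split; first by exists z.
  by move=> /(word_map_inj f_inj).
apply: connected_continuous_connected.
  apply: contrapT => nconn; apply: ncut; exists y; split=> //; split=> //.
  by move=> _ ->.
by apply: continuous_subspaceT; exact: continuous_word_map.
Qed.

Lemma piece_in_open (U V : set M) (n : nat) (x : M) :
  ~ (exists x, cut_point T x) ->
  open U -> open V -> U `&` V = set0 -> ~ U x -> closure (T `&` U) x ->
  (forall a : n.-tuple 'I_q, (word_map f a @` T) x ->
     (word_map f a @` T) `\ x `<=` U `|` V) ->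
  exists a : n.-tuple 'I_q,
    (word_map f a @` T) x /\ (word_map f a @` T) `\ x `<=` U.
Proof.
move=> ncut oU oV UV0 nUx clUx aUV; have [_ cT _] := T_attr.
have clK : closed (\bigcup_(a in [set a : n.-tuple 'I_q |
    ~ (word_map f a @` T) x]) (word_map f a @` T)).
  apply: closed_bigcup; first exact: finite_finset.
  move=> a _; apply: compact_closed; first exact: metric_hausdorff.
  apply: continuous_compact => //.
  by apply: continuous_subspaceT; exact: continuous_word_map.
have [|u [[Tu Uu] nKu]] := clUx (~` _) (open_nbhs_nbhs (conj (closed_openC clK) _)).
  by move=> [].
have [a _ au] := attractor_words n Tu.
have ax : (word_map f a @` T) x.
  by apply: contrapT => nax; apply: nKu; exists a.
exists a; split=> //.
have [//|aV] := connected_subset (open_separated oU oV UV0) (aUV a ax)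
  (connected_punctured_piece ncut ax).
have /aV Vu : ((word_map f a @` T) `\ x) u.
  by split=> // ux; apply: nUx; rewrite -ux.
by have := (disjoints_subset _ _).1 UV0 _ Uu Vu.
Qed.

End word_map.

Theorem theorem2p1 (R : realType) (M : completeMetricType R) (q : nat)
    (f : 'I_q -> M -> M) (T : set M)
    (f_inj : forall i, injective (f i))
    (f_contr : forall i, metric_contraction (f i))
    (T_attr : attractor f T)
    (T_conn : connected T) :
  (exists x, cut_point T x) \/
  (forall X : set M, irreducible_cut_set T X ->
    exists X0 : set M,
      [/\ X = limit_point X `|` X0,
          limit_point X `&` X0 = set0 &
          X0 `<=` single_overlaps f T]).
Proof.
have [cut|ncut] := pselect (exists x, cut_point T x); [by left|right].
move=> X irrX; have [_ cT _] := T_attr.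
have clT : closed T by apply: compact_closed => //; exact: metric_hausdorff.
have [U [V [[oU oV UV0] TU0 TV0 XE]]] := irreducible_cut_set_open clT irrX.
have clX : closed X.
  by rewrite XE; apply: closedI => //; apply: open_closedC; exact: openU.
exists (isolated X); split.
- by rewrite setUC -closure_isolated_limit_point -(closure_id X).1.
- by rewrite setIC; apply/disj_set2P; exact: disjoint_isolated_limit_point.
move=> x isox; have Xx := isolatedS isox.
have clUx := irreducible_cut_set_isolated_closure
  clT irrX oU oV UV0 TU0 TV0 XE isox.
have clVx : closure (T `&` V) x.
  apply: (irreducible_cut_set_isolated_closure clT irrX oV oU) isox => //.
    by rewrite setIC.
  by rewrite setUC.
move: (Xx); rewrite {1}XE => -[Tx nUVx].
have [_ [W xW WX]] := isox.
move: xW; rewrite -nbhs_ballE => -[e /= e0 eW].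
have [n n0 ne] := attractor_small_pieces T_attr f_contr e0.
have aUV (a : n.-tuple 'I_q) : (word_map f a @` T) x ->
    (word_map f a @` T) `\ x `<=` U `|` V.
  move=> [y Ty yx] z [[t Tt tz] zx].
  have Wz : W z by apply: eW; rewrite ballEmdist/= -yx -tz; exact: ne.
  have Tz : T z by apply: (word_map_attractor T_attr (a := a)); exists t.
  apply: contrapT => nUVz; apply: zx.
  by have : (W `&` X) z by [split=> //; rewrite XE]; rewrite WX.
have [a [ax aU]] := piece_in_open T_attr f_inj f_contr ncut oU oV UV0
  (fun Ux => nUVx (or_introl Ux)) clUx aUV.
have [b [bx bV]] : exists a : n.-tuple 'I_q,
    (word_map f a @` T) x /\ (word_map f a @` T) `\ x `<=` V.
  apply: (piece_in_open T_attr f_inj f_contr ncut oV oU) clVx _.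
  - by rewrite setIC.
  - by move=> Vx; apply: nUVx; right.
  - by move=> a' a'x; rewrite setUC; exact: aUV.
have abE : (word_map f a @` T) `&` (word_map f b @` T) = [set x].
  apply/seteqP; split=> [y [ay bY]|_ ->//].
  apply: contrapT => yx.
  exact: (disjoints_subset _ _).1 UV0 y (aU y (conj ay yx)) (bV y (conj bY yx)).
exists (tval a, tval b); last by rewrite abE.
split=> /=; last by rewrite abE card_set1.
- by rewrite -size_eq0 size_tuple -lt0n.
- by rewrite -size_eq0 size_tuple -lt0n.
Qed.
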